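(* Let $\boldsymbol{\alpha}^\perp\in C^2(\mathbb{R},\mathbb{R}^2)$ with $\boldsymbol{\alpha}^\perp(\xi)=0$ for $\xi\le0$, let $K\ge 0$, and let $\gamma_e^{(0)},Y_e^3,\Xi_e,z_e^{(0)}$ be defined from $\boldsymbol{\alpha}^\perp$ as in the context. For $Z\ge0$ and $x^0\ge Z$ put $$\tilde r_e^{(0)}(x^0,Z):=4K\int_Z^{x^0}\frac{z_e^{(0)}(s,Z)\,\theta[z_e^{(0)}(s,Z)]-Z\,\theta(Z)}{\gamma_e^{(0)}[s-z_e^{(0)}(s,Z)]}\,ds ,$$ where $\theta$ is the Heaviside step function. Then $$\tilde r_e^{(0)}(x^0,Z)=4K\,V_e^3\big[\Xi_e^{-1}(x^0-Z)\big],\qquad V_e^3(\xi):=\int_0^\xi Y_e^3(y)\,dy .$$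
   Context: Let $m_e>0$ and $-e$ be the electron mass and charge, $c>0$ the speed of light. For $\xi\in\mathbb{R}$: $$\boldsymbol{u}_e^{\perp(0)}(\xi):=\frac{e}{m_ec^2}\boldsymbol{\alpha}^\perp(\xi),\quad u_e^{z(0)}:=\tfrac12|\boldsymbol{u}_e^{\perp(0)}|^2,\quad \gamma_e^{(0)}:=1+u_e^{z(0)},\quad Y_e^3(\xi):=\int_0^\xi u_e^{z(0)}(\xi')d\xi',\quad \Xi_e(\xi):=\xi+Y_e^3(\xi).$$ $\Xi_e$ is strictly increasing and invertible, and $z_e^{(0)}(x^0,Z):=x^0-\Xi_e^{-1}(x^0-Z)$ is the zero-density approximation of the longitudinal position at time $x^0$ of the electrons initially at $Z$. In the application $K=\pi e^2n_0/(m_ec^2)$, where $n_0$ is the constant initial electron density in $Z>0$, and $e^{\tilde r_e^{(0)}}$ is the first corrected approximation of $\tilde\gamma_e-\tilde u_e^z$. *)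

(* Defs.v *)
From Stdlib Require Import Reals ClassicalEpsilon.
From Coquelicot Require Import Coquelicot.
Open Scope R_scope.

(* [Derive] and [ex_derive_n] only apply to real-valued functions, so the
   derivatives of an R^2-valued function are quantified explicitly. *)
Definition C2 (f : R -> R * R) : Prop :=
  exists f1 f2 : R -> R * R,
    (forall x, is_derive f x (f1 x)) /\
    (forall x, is_derive f1 x (f2 x)) /\
    (forall x, continuous f2 x).

(* The value at 0 is a convention; here it only matters through x * theta x. *)
Definition theta (x : R) : R := if Rlt_dec 0 x then 1 else 0.

(* Meaningful only for bijective f. *)
Definition inverse (f : R -> R) (y : R) : R :=
  epsilon (inhabits 0) (fun x => f x = y).

Definition u_perp0 (m_e e c : R) (alpha : R -> R * R) (xi : R) : R * R :=
  scal (e / (m_e * c ^ 2)) (alpha xi).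

(* [norm] on the product R * R is the Euclidean norm. *)
Definition u_z0 (m_e e c : R) (alpha : R -> R * R) (xi : R) : R :=
  / 2 * norm (u_perp0 m_e e c alpha xi) ^ 2.

Definition gamma0 (m_e e c : R) (alpha : R -> R * R) (xi : R) : R :=
  1 + u_z0 m_e e c alpha xi.

Definition Y3 (m_e e c : R) (alpha : R -> R * R) (xi : R) : R :=
  RInt (u_z0 m_e e c alpha) 0 xi.

Definition Xi (m_e e c : R) (alpha : R -> R * R) (xi : R) : R :=
  xi + Y3 m_e e c alpha xi.

Definition Xi_inv (m_e e c : R) (alpha : R -> R * R) : R -> R :=
  inverse (Xi m_e e c alpha).

Definition z0 (m_e e c : R) (alpha : R -> R * R) (x0 Z : R) : R :=
  x0 - Xi_inv m_e e c alpha (x0 - Z).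

Definition V3 (m_e e c : R) (alpha : R -> R * R) (xi : R) : R :=
  RInt (Y3 m_e e c alpha) 0 xi.

Definition r0 (m_e e c : R) (alpha : R -> R * R) (K x0 Z : R) : R :=
  4 * K *
  RInt (fun s =>
          (z0 m_e e c alpha s Z * theta (z0 m_e e c alpha s Z) - Z * theta Z)
          / gamma0 m_e e c alpha (s - z0 m_e e c alpha s Z))
       Z x0.

(* Main.v *)
(** For [s >= Z >= 0] put [xi = Xi_inv (s - Z)]. Then [xi >= 0] and
    [z0 s Z = s - xi = Z + Y3 xi >= 0], so the step functions disappear and the
    integrand is [Y3 xi / gamma0 xi]. Since [Xi' = gamma0], the substitution
    [s = Z + Xi xi] turns the integral into that of [Y3] over [[0, Xi_inv (x0 - Z)]].
    As [gamma0 >= 1], [Xi] expands distances, which yields both its bijectivity and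
    the continuity of [Xi_inv]. *)
Require Import Defs.
From Stdlib Require Import Reals ClassicalEpsilon Lra.
From Coquelicot Require Import Coquelicot.
Open Scope R_scope.

(** At [x = 0] the factor [x] cancels whatever value [theta] takes there. *)
Lemma mult_theta_nonneg (x : R) : 0 <= x -> x * theta x = x.
Proof. intros Hx; unfold theta; destruct (Rlt_dec 0 x); lra. Qed.

(** Equivalent to [f - id] being nondecreasing. This single condition yields injectivity,
    unboundedness in both directions and a 1-Lipschitz inverse. *)
Definition expanding (f : R -> R) : Prop :=
  forall a b, a <= b -> b - a <= f b - f a.

Lemma expanding_surjective (f : R -> R) (y : R) :
  expanding f -> (forall x, continuous f x) -> exists x, f x = y.
Proof.
  intros Hf Hc.
  (* Expansion over a distance [d] from 0 gives [f (- d) <= f 0 - d <= y <= f 0 + d <= f d], so the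
     intermediate value theorem applies on [[- d, d]]. *)
  set (d := Rabs (y - f 0)).
  assert (Hd : 0 <= d) by apply Rabs_pos.
  assert (Hl : y - f 0 <= d) by apply Rle_abs.
  assert (Hr : - (y - f 0) <= d) by (unfold d; rewrite <- Rabs_Ropp; apply Rle_abs).
  assert (H1 := Hf 0 d Hd).
  assert (H2 : 0 - - d <= f 0 - f (- d)) by (apply Hf; lra).
  destruct (IVT_gen f (- d) d y) as [x [_ Hx]].
  - intros x; apply continuity_pt_filterlim, Hc.
  - rewrite Rmin_left, Rmax_right by lra; lra.
  - now exists x.
Qed.

Lemma inverse_right (f : R -> R) (y : R) :
  (exists x, f x = y) -> f (inverse f y) = y.
Proof. exact (epsilon_spec (inhabits 0) (fun x => f x = y)). Qed.

Lemma expanding_dist (f : R -> R) (a b : R) :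
  expanding f -> Rabs (b - a) <= Rabs (f b - f a).
Proof.
  intros Hf; destruct (Rle_dec a b) as [Hab | Hab].
  - assert (H := Hf a b Hab); rewrite !Rabs_pos_eq; lra.
  - assert (H : a - b <= f a - f b) by (apply Hf; lra).
    rewrite !Rabs_left1; lra.
Qed.

Lemma expanding_injective (f : R -> R) (a b : R) :
  expanding f -> f a = f b -> a = b.
Proof.
  intros Hf Hab; assert (H := expanding_dist f a b Hf).
  rewrite Hab, Rminus_diag, Rabs_R0 in H.
  destruct (Req_dec (b - a) 0) as [E | E]; [lra|].
  apply Rabs_pos_lt in E; lra.
Qed.

(** [epsilon] returns some preimage of [f x]; injectivity forces it to be [x]. *)
Lemma inverse_left (f : R -> R) (x : R) :
  expanding f -> inverse f (f x) = x.
Proof.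
  intros Hf; apply (expanding_injective f); [exact Hf|].
  apply inverse_right; now exists x.
Qed.

(** Expansion of [f] makes the inverse 1-Lipschitz, so [eps] itself serves as the radius. *)
Lemma continuous_inverse (f : R -> R) (y : R) :
  expanding f -> (forall x, continuous f x) -> continuous (inverse f) y.
Proof.
  intros Hf Hc; apply filterlim_locally; intros eps; exists eps; intros z Hz.
  change (Rabs (z - y) < eps) in Hz.
  change (Rabs (inverse f z - inverse f y) < eps).
  eapply Rle_lt_trans; [apply (expanding_dist f _ _ Hf)|].
  now rewrite !inverse_right by (now apply expanding_surjective).
Qed.

Lemma continuous_u_z0 (m_e e c : R) (alpha : R -> R * R) (x : R) :
  continuous alpha x -> continuous (u_z0 m_e e c alpha) x.
Proof.
  intros Ha; unfold u_z0, u_perp0.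
  (* The norm is kept as a single continuous function, and its square is then treated as a product,
     without passing to coordinates. *)
  set (n := fun y => norm (scal (e / (m_e * c ^ 2)) (alpha y))).
  assert (Hn : continuous n x).
  { unfold n; apply (continuous_comp (fun y => scal _ (alpha y)) norm).
    - now apply (continuous_scal_r
               (V := prod_NormedModule R_AbsRing R_NormedModule R_NormedModule)).
    - apply (filterlim_norm
               (V := prod_NormedModule R_AbsRing R_NormedModule R_NormedModule)). }
  apply (continuous_ext (fun y => mult (/ 2) (mult (n y) (n y)))).
  - intros y; unfold mult; cbn; fold (n y); ring.
  - apply (continuous_mult (K := R_AbsRing)); [apply continuous_const|].
    now apply (continuous_mult (K := R_AbsRing) n n).
Qed.

Lemma u_z0_ge0 (m_e e c : R) (alpha : R -> R * R) (x : R) :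
  0 <= u_z0 m_e e c alpha x.
Proof. apply Rmult_le_pos; [lra | apply pow2_ge_0]. Qed.

Lemma Y3_0 (m_e e c : R) (alpha : R -> R * R) : Y3 m_e e c alpha 0 = 0.
Proof. apply (RInt_point (V := R_CompleteNormedModule)). Qed.

Lemma Xi_0 (m_e e c : R) (alpha : R -> R * R) : Xi m_e e c alpha 0 = 0.
Proof. unfold Xi; rewrite Y3_0; ring. Qed.

Lemma ex_RInt_u_z0 (m_e e c : R) (alpha : R -> R * R) (a b : R) :
  (forall x, continuous alpha x) -> ex_RInt (u_z0 m_e e c alpha) a b.
Proof.
  intros Ha; apply (ex_RInt_continuous (V := R_CompleteNormedModule)).
  intros x _; now apply continuous_u_z0.
Qed.

Lemma is_derive_Y3 (m_e e c : R) (alpha : R -> R * R) (x : R) :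
  (forall x, continuous alpha x) ->
  is_derive (Y3 m_e e c alpha) x (u_z0 m_e e c alpha x).
Proof.
  intros Ha; apply (is_derive_RInt _ _ 0).
  - apply filter_forall; intros y.
    now apply (RInt_correct (V := R_CompleteNormedModule)), ex_RInt_u_z0.
  - now apply continuous_u_z0.
Qed.

Lemma continuous_Y3 (m_e e c : R) (alpha : R -> R * R) (x : R) :
  (forall x, continuous alpha x) -> continuous (Y3 m_e e c alpha) x.
Proof.
  intros Ha; apply (ex_derive_continuous (V := R_NormedModule)).
  eexists; now apply is_derive_Y3.
Qed.

Lemma is_derive_Xi (m_e e c : R) (alpha : R -> R * R) (x : R) :
  (forall x, continuous alpha x) ->
  is_derive (Xi m_e e c alpha) x (gamma0 m_e e c alpha x).
Proof.
  intros Ha; apply (is_derive_plus (fun y : R => y) (Y3 m_e e c alpha)).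
  - apply (is_derive_id (K := R_AbsRing)).
  - now apply is_derive_Y3.
Qed.

Lemma continuous_Xi (m_e e c : R) (alpha : R -> R * R) (x : R) :
  (forall x, continuous alpha x) -> continuous (Xi m_e e c alpha) x.
Proof.
  intros Ha; apply (ex_derive_continuous (V := R_NormedModule)).
  eexists; now apply is_derive_Xi.
Qed.

Lemma continuous_gamma0 (m_e e c : R) (alpha : R -> R * R) (x : R) :
  continuous alpha x -> continuous (gamma0 m_e e c alpha) x.
Proof.
  intros Ha; apply (continuous_plus (fun _ => 1) (u_z0 m_e e c alpha)).
  - apply continuous_const.
  - now apply continuous_u_z0.
Qed.

(** The difference of the two sides is the integral of the nonnegative [u_z0] over [[a, b]].
    Splitting by Chasles makes the position of 0 relative to [a] and [b] irrelevant. *)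
Lemma Y3_le (m_e e c : R) (alpha : R -> R * R) (a b : R) :
  (forall x, continuous alpha x) -> a <= b ->
  Y3 m_e e c alpha a <= Y3 m_e e c alpha b.
Proof.
  intros Ha Hab; unfold Y3.
  rewrite <- (RInt_Chasles (V := R_CompleteNormedModule) _ 0 a b)
    by now apply ex_RInt_u_z0.
  assert (H : 0 <= RInt (u_z0 m_e e c alpha) a b).
  { apply RInt_ge_0; [exact Hab | now apply ex_RInt_u_z0 |].
    intros; apply u_z0_ge0. }
  rewrite <- (Rplus_0_r (RInt _ 0 a)) at 1.
  now apply Rplus_le_compat_l.
Qed.

(** [Xi - id] is [Y3], which is nondecreasing. *)
Lemma expanding_Xi (m_e e c : R) (alpha : R -> R * R) :
  (forall x, continuous alpha x) -> expanding (Xi m_e e c alpha).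
Proof.
  intros Ha a b Hab; assert (H := Y3_le m_e e c alpha a b Ha Hab).
  unfold Xi; lra.
Qed.

Lemma Xi_Xi_inv (m_e e c : R) (alpha : R -> R * R) (y : R) :
  (forall x, continuous alpha x) ->
  Xi m_e e c alpha (Xi_inv m_e e c alpha y) = y.
Proof.
  intros Ha; apply inverse_right, expanding_surjective.
  - now apply expanding_Xi.
  - intros x; now apply continuous_Xi.
Qed.

Lemma Xi_inv_Xi (m_e e c : R) (alpha : R -> R * R) (x : R) :
  (forall x, continuous alpha x) ->
  Xi_inv m_e e c alpha (Xi m_e e c alpha x) = x.
Proof. intros Ha; now apply inverse_left, expanding_Xi. Qed.

Lemma continuous_Xi_inv (m_e e c : R) (alpha : R -> R * R) (y : R) :
  (forall x, continuous alpha x) -> continuous (Xi_inv m_e e c alpha) y.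
Proof.
  intros Ha; apply continuous_inverse.
  - now apply expanding_Xi.
  - intros x; now apply continuous_Xi.
Qed.

(** If [xi = Xi_inv y] were negative, expansion between [xi] and 0, together with [Xi 0 = 0], would
    give [y <= xi < 0]. *)
Lemma Xi_inv_ge0 (m_e e c : R) (alpha : R -> R * R) (y : R) :
  (forall x, continuous alpha x) -> 0 <= y -> 0 <= Xi_inv m_e e c alpha y.
Proof.
  intros Ha Hy; apply Rnot_lt_le; intros Hn.
  assert (H := expanding_Xi m_e e c alpha Ha _ _ (Rlt_le _ _ Hn)).
  rewrite Xi_0, Xi_Xi_inv in H by exact Ha; lra.
Qed.

(** A rearrangement of [xi + Y3 xi = s - Z] at [xi = Xi_inv (s - Z)]. *)
Lemma z0_eq (m_e e c : R) (alpha : R -> R * R) (s Z : R) :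
  (forall x, continuous alpha x) ->
  z0 m_e e c alpha s Z = Z + Y3 m_e e c alpha (Xi_inv m_e e c alpha (s - Z)).
Proof.
  intros Ha; unfold z0; assert (H := Xi_Xi_inv m_e e c alpha (s - Z) Ha).
  unfold Xi at 1 in H; lra.
Qed.

Lemma gamma0_neq0 (m_e e c : R) (alpha : R -> R * R) (x : R) :
  gamma0 m_e e c alpha x <> 0.
Proof. assert (H := u_z0_ge0 m_e e c alpha x); unfold gamma0; lra. Qed.

Lemma r0_integrand (m_e e c : R) (alpha : R -> R * R) (s Z : R) :
  (forall x, continuous alpha x) -> 0 <= Z <= s ->
  (z0 m_e e c alpha s Z * theta (z0 m_e e c alpha s Z) - Z * theta Z)
    / gamma0 m_e e c alpha (s - z0 m_e e c alpha s Z)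
  = Y3 m_e e c alpha (Xi_inv m_e e c alpha (s - Z))
    / gamma0 m_e e c alpha (Xi_inv m_e e c alpha (s - Z)).
Proof.
  intros Ha [HZ Hs].
  (* Here [Z <= s] enters: it places [Xi_inv (s - Z)] to the right of 0, where [Y3] is nonnegative.
     With [0 <= Z], both arguments of [theta] are then nonnegative. *)
  assert (HY : 0 <= Y3 m_e e c alpha (Xi_inv m_e e c alpha (s - Z))).
  { rewrite <- (Y3_0 m_e e c alpha); apply Y3_le; [exact Ha|].
    apply Xi_inv_ge0; [exact Ha | lra]. }
  replace (s - z0 m_e e c alpha s Z) with (Xi_inv m_e e c alpha (s - Z))
    by (unfold z0; ring).
  rewrite z0_eq, !mult_theta_nonneg by (assumption || lra).
  f_equal; ring.
Qed.

Lemma continuous_Y3_div_gamma0 (m_e e c : R) (alpha : R -> R * R) (x : R) :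
  (forall x, continuous alpha x) ->
  continuous (fun y => Y3 m_e e c alpha y / gamma0 m_e e c alpha y) x.
Proof.
  intros Ha.
  apply (continuous_mult (K := R_AbsRing) (Y3 m_e e c alpha)
           (fun y => / gamma0 m_e e c alpha y)).
  - now apply continuous_Y3.
  - apply (continuous_Rinv_comp (gamma0 m_e e c alpha)).
    + now apply continuous_gamma0.
    + apply gamma0_neq0.
Qed.

Theorem mainTheorem5 (m_e e c : R) (Hm : 0 < m_e) (Hc : 0 < c)
  (alpha : R -> R * R) (Halpha : C2 alpha)
  (Halpha0 : forall xi : R, xi <= 0 -> alpha xi = (0, 0))
  (K : R) (HK : 0 <= K)
  (Z x0 : R) (HZ : 0 <= Z) (Hx0 : Z <= x0) :
  r0 m_e e c alpha K x0 Z
  = 4 * K * V3 m_e e c alpha (Xi_inv m_e e c alpha (x0 - Z)).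
Proof.
  assert (Ha : forall x, continuous alpha x).
  { destruct Halpha as [f1 [_ [H _]]]; intros x.
    apply (ex_derive_continuous
             (V := prod_NormedModule R_AbsRing R_NormedModule R_NormedModule)).
    now exists (f1 x). }
  unfold r0, V3; f_equal.
  set (xi0 := Xi_inv m_e e c alpha (x0 - Z)).
  (* [f] is the integrand freed of step functions. It is shown to equal the original one for
     [s >= Z], and it is continuous on the whole line, as the substitution rule is given below. *)
  set (f := fun s => Y3 m_e e c alpha (Xi_inv m_e e c alpha (s - Z))
                     / gamma0 m_e e c alpha (Xi_inv m_e e c alpha (s - Z))).
  set (g := fun xi => Z + Xi m_e e c alpha xi).
  assert (Hginv : forall xi, Xi_inv m_e e c alpha (g xi - Z) = xi).
  { intros xi; unfold g; replace (Z + _ - Z) with (Xi m_e e c alpha xi) by ring.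
    now apply Xi_inv_Xi. }
  assert (Hf : forall s, continuous f s).
  { intros s.
    apply (continuous_comp (fun s => Xi_inv m_e e c alpha (s - Z))
             (fun y => Y3 m_e e c alpha y / gamma0 m_e e c alpha y)).
    - apply (continuous_comp (fun s => s - Z) (Xi_inv m_e e c alpha)).
      + apply (continuous_minus (fun s : R => s) (fun _ => Z)).
        * apply continuous_id.
        * apply continuous_const.
      + now apply continuous_Xi_inv.
    - now apply continuous_Y3_div_gamma0. }
  (* The endpoints [Z] and [x0] are written as values of [g], the form that [RInt_comp] expects. *)
  transitivity (RInt f (g 0) (g xi0)).
  - replace (g 0) with Z by (unfold g; rewrite Xi_0; ring).
    replace (g xi0) with x0 by (unfold g, xi0; rewrite Xi_Xi_inv by exact Ha; ring).
    apply RInt_ext; intros s Hs.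
    rewrite Rmin_left, Rmax_right in Hs by exact Hx0.
    apply r0_integrand; [exact Ha | lra].
  - rewrite <- (RInt_comp f g (gamma0 m_e e c alpha)).
    (* The factor [gamma0 xi] coming from the derivative of [g] cancels the denominator of
       [f (g xi)], leaving [Y3 xi]. *)
    + apply RInt_ext; intros xi _; unfold f; rewrite Hginv.
      unfold scal; cbn; unfold mult; cbn.
      field; apply gamma0_neq0.
    + intros xi _; apply Hf.
    + intros xi _; split.
      (* The added zero is the derivative of the constant [Z] in [g]. *)
      * rewrite <- (plus_zero_l (gamma0 m_e e c alpha xi)).
        apply (is_derive_plus (fun _ => Z) (Xi m_e e c alpha)).
        -- apply (is_derive_const (K := R_AbsRing) (V := R_NormedModule)).
        -- now apply is_derive_Xi.
      * now apply continuous_gamma0.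
Qed.
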